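(* Let $t\ge 1$ be an odd integer and $r=2t$. Then each maximum matching of the graph $B_{2t}$ is a perfect matching of cardinality $\frac{3}{4}r+\frac{3}{2}$.
   Context: For an integer $t\ge 1$, $B_{2t}$ is the simple graph with vertex set $\{v_1,\dots,v_{3t+3}\}$ and edge set $\{\{v_i,v_{i+1}\} : 1\le i\le 3t+2,\ i\ne t+1,\ i\neq 2t+2\}\cup\{\{v_i,v_{i+t+1}\} : 1\le i\le 2t+2\}$ (a grid of unit squares with 2 rows and $t$ columns of squares); $r=2t$ is its number of (bounded) regions. A matching is a set of pairwise disjoint edges. A maximum matching is a matching $\mathcal{M}$ with $|\mathcal{M}'|\le|\mathcal{M}|$ for every matching $\mathcal{M}'$. A perfect matching is a matching covering all the vertices. *)

(* Defs.v *)
From mathcomp Require Import all_boot all_order all_algebra.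

Set Implicit Arguments.
Unset Strict Implicit.
Unset Printing Implicit Defensive.

Record sgraph (T : finType) := SGraph {
  edges : {set {set T}};
  edges_card2 : forall e : {set T}, e \in edges -> #|e| = 2
}.

Definition matching (T : finType) (G : sgraph T) (M : {set {set T}}) : bool :=
  (M \subset edges G) && trivIset M.

Definition maximum_matching (T : finType) (G : sgraph T) (M : {set {set T}}) :
    Prop :=
  matching G M /\ forall M' : {set {set T}}, matching G M' -> #|M'| <= #|M|.

Definition perfect_matching (T : finType) (G : sgraph T) (M : {set {set T}}) :
    Prop :=
  matching G M /\ cover M = [set: T].

(* The ordinal u stands for the vertex v_(u + 1). *)
Definition label (n : nat) (u : 'I_n) : nat := u.+1.

Definition grid_step (t : nat) : rel 'I_(3 * t + 3) := fun u w =>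
  let i := label u in
  [&& 1 <= i <= 3 * t + 2, i != t + 1, i != 2 * t + 2 & label w == i + 1]
  || (1 <= i <= 2 * t + 2) && (label w == i + t + 1).

Definition grid_edges (t : nat) : {set {set 'I_(3 * t + 3)}} :=
  [set e | [exists u, exists w, grid_step u w && (e == [set u; w])]].

Lemma grid_edges_card2 (t : nat) (e : {set 'I_(3 * t + 3)}) :
  e \in grid_edges t -> #|e| = 2.
Proof.
rewrite inE => /existsP[u /existsP[w /andP[st /eqP->]]].
rewrite cards2; suff -> : u != w by [].
apply: contraTneq st => <-; rewrite /grid_step /label.
have neq i k : (i == i + k.+1) = false.
  by rewrite ltn_eqF // addnS ltnS leq_addr.
by rewrite -addnA !addn1 -[u.+2]addn1 !neq !andbF.
Qed.

(* B2 t is B_(2t): the argument is the number of columns of squares, not the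
   number 2t of squares. *)
Definition B2 (t : nat) : sgraph 'I_(3 * t + 3) :=
  SGraph (@grid_edges_card2 t).

(* Main.v *)
(* When t is odd the three rows of the grid have t + 1 vertices, an even number,
   so pairing consecutive vertices along the rows is a perfect matching.
   Counting covered vertices, every maximum matching is then perfect. *)
Require Import Defs.
From mathcomp Require Import all_boot all_order all_algebra.
From mathcomp Require Import zify ring.

Lemma card_cover_matching {T : finType} {G : sgraph T} {M : {set {set T}}} :
  matching G M -> #|cover M| = #|M| * 2.
Proof.
case/andP=> /subsetP sMG /eqP <-; rewrite -sum_nat_const.
by apply: eq_bigr => e /sMG; apply: edges_card2.
Qed.

(** Any matching covers twice as many vertices as it has edges, so a maximum [M] covers at least as
    many as the perfect [N], hence all. *)
Lemma maximum_matching_perfect {T : finType} {G : sgraph T}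
    {M N : {set {set T}}} :
  perfect_matching G N -> maximum_matching G M -> perfect_matching G M.
Proof.
case=> mN cN [mM maxM]; split=> //; apply/eqP.
rewrite eqEcard subsetT -cN (card_cover_matching mN) (card_cover_matching mM).
by rewrite leq_mul2r maxM.
Qed.

Lemma grid_edge_half (t : nat) (u : 'I_(3 * t + 3)) :
  odd t -> [set w : 'I_(3 * t + 3) | u./2 == w./2] \in grid_edges t.
Proof.
move=> t_odd; have lt_u := ltn_ord u.
have lt0 : u./2.*2 < 3 * t + 3 by lia.
(* The successor stays in range because [3 * t + 3] is even for odd [t]. *)
have lt1 : u./2.*2.+1 < 3 * t + 3 by lia.
rewrite inE; apply/existsP; exists (Ordinal lt0).
apply/existsP; exists (Ordinal lt1); apply/andP; split.
  (* A horizontal edge: the label [u./2.*2.+1] is odd, while the row ends [t + 1] and [2 * t + 2]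
     are even. *)
  by rewrite /grid_step /label /=; apply/orP; left; lia.
by apply/eqP/setP=> w; rewrite !inE -!val_eqE /=; lia.
Qed.

(** Taking the pairs as the fibres of halving makes disjointness and covering instances of
    [preim_partitionP]; only membership in the edge set is left. *)
Lemma perfect_matching_half {t : nat} : odd t ->
  perfect_matching (B2 t)
    (preim_partition (fun u : 'I_(3 * t + 3) => u./2) [set: _]).
Proof.
move=> t_odd.
have /and3P[/eqP covT trivT _] :=
  preim_partitionP (fun u : 'I_(3 * t + 3) => u./2) [set: _].
split=> //; rewrite /matching trivT andbT.
apply/subsetP=> _ /imsetP[u _ ->].
rewrite (_ : [set _ in _ | _] = [set w : 'I_(3 * t + 3) | u./2 == w./2]).
  exact: grid_edge_half.
by apply/setP=> w; rewrite !inE.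
Qed.

Theorem theorem4p8 (t r : nat) (ht : 1 <= t) (t_odd : odd t) (hr : r = 2 * t)
    (M : {set {set 'I_(3 * t + 3)}}) :
  maximum_matching (B2 t) M ->
  perfect_matching (B2 t) M /\
  (#|M|%:R = 3%:R / 4%:R * r%:R + 3%:R / 2%:R :> rat)%R.
Proof.
move=> maxM.
have perfM := maximum_matching_perfect (perfect_matching_half t_odd) maxM.
split=> //; have [mM covM] := perfM.
have := card_cover_matching mM; rewrite covM cardsT card_ord.
move: #|M| => m card_m.
have {}card_m : (3%:R * t%:R + 3%:R = m%:R * 2%:R :> rat)%R.
  by rewrite -!GRing.natrM -GRing.natrD card_m.
have -> : (m%:R = (3%:R * t%:R + 3%:R) / 2%:R :> rat)%R.
  by rewrite card_m; field.
by rewrite hr GRing.natrM; field.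
Qed.
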